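(* Let $\mathbb{F}$ be a field, let $(\mathsf{Zin},\mu,\eta)$ be the free Zinbiel algebra monad on the category $\mathbb{F}\text{-}\mathsf{VEC}$ of $\mathbb{F}$-vector spaces, let $\partial_V:\mathsf{Zin}(V)\to\mathsf{Zin}(V\times V)$ be the linear map given on pure tensors by $$\partial_V(v_1\otimes v_2\otimes\cdots\otimes v_n)=(0,v_1)\otimes(v_2,0)\otimes\cdots\otimes(v_n,0),$$ and let $\varepsilon_V:\mathsf{Zin}(V)\to V$ be the linear map with $\varepsilon_V(v_1\otimes\cdots\otimes v_n)=v_1$ if $n=1$ and $0$ otherwise. Then $(\mathsf{Zin},\mu,\eta,\partial)$ is a Cartesian differential comonad on $\mathbb{F}\text{-}\mathsf{VEC}^{op}$ with $\mathsf{D}$-linear unit $\varepsilon$. Therefore $\mathbb{F}\text{-}\mathsf{VEC}^{op}_{\mathsf{Zin}}$ is a Cartesian differential category and $\mathsf{D}\text{-}\mathsf{lin}[\mathbb{F}\text{-}\mathsf{VEC}^{op}_{\mathsf{Zin}}]\cong\mathbb{F}\text{-}\mathsf{VEC}^{op}$.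
   Context: The monad $\mathsf{Zin}$. A Zinbiel algebra over $\mathbb{F}$ is an $\mathbb{F}$-vector space $A$ with a bilinear operation $<$ satisfying $(a<b)<c=a<(b<c)+a<(c<b)$. For an $\mathbb{F}$-vector space $V$, $\mathsf{Zin}(V)=\bigoplus_{n\ge1}V^{\otimes n}$, the free Zinbiel algebra on $V$, with product given on pure tensors by $$(v_1\otimes\cdots\otimes v_n)<(w_1\otimes\cdots\otimes w_m)=\sum_{\sigma}v_1\otimes\sigma\cdot(v_2\otimes\cdots\otimes v_n\otimes w_1\otimes\cdots\otimes w_m),$$ where $\sigma$ runs over the $(n-1,m)$-shuffles (representatives of $S(n+m-1)/(S(n-1)\times S(m))$), i.e. the sum is over all interleavings of the words $v_2\cdots v_n$ and $w_1\cdots w_m$ preserving the internal order of each word; the product is extended bilinearly. For linear $f:V\to W$, $\mathsf{Zin}(f)(v_1\otimes\cdots\otimes v_n)=f(v_1)\otimes\cdots\otimes f(v_n)$. The unit is the inclusion $\eta_V(v)=v$. The multiplication $\mu_V:\mathsf{Zin}\mathsf{Zin}(V)\to\mathsf{Zin}(V)$ is the linear map with $\mu_V(\mathfrak{v}_1\otimes\cdots\otimes\mathfrak{v}_n)=\mathfrak{v}_1<(\cdots(\mathfrak{v}_{n-1}<\mathfrak{v}_n)\cdots)$ for $\mathfrak{v}_1,\dots,\mathfrak{v}_n\in\mathsf{Zin}(V)$. It is known that $(\mathsf{Zin},\mu,\eta)$ is a monad on $\mathbb{F}\text{-}\mathsf{VEC}$. Dual notions. Let $(\mathsf{S},\mu,\eta)$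 be a monad on a category $\mathbb{X}$ with finite biproducts $\times$ (projections $\pi_j$, injections $\iota_j$, diagonal $\Delta_V=\langle1_V,1_V\rangle$, copairing $[-,-]$, $c_V=\langle\pi_0\times\pi_0,\pi_1\times\pi_1\rangle$ on $(V\times V)\times(V\times V)$). A differential combinator transformation on it is a natural transformation $\partial_V:\mathsf{S}(V)\to\mathsf{S}(V\times V)$ with: [dc.1] $\mathsf{S}(\pi_0)\circ\partial_V=0$; [dc.2] $\mathsf{S}(1_V\times\Delta_V)\circ\partial_V=(\mathsf{S}(1_V\times\iota_0)+\mathsf{S}(1_V\times\iota_1))\circ\partial_V$; [dc.3] $\partial_V\circ\eta_V=\eta_{V\times V}\circ\iota_1$; [dc.4] $\partial_V\circ\mu_V=\mu_{V\times V}\circ\mathsf{S}([\mathsf{S}(\iota_0),\partial_V])\circ\partial_{\mathsf{S}(V)}$; [dc.5] $\mathsf{S}(\pi_0\times\pi_1)\circ\partial_{V\times V}\circ\partial_V=\partial_V$; [dc.6] $\mathsf{S}(c_V)\circ\partial_{V\times V}\circ\partial_V=\partial_{V\times V}\circ\partial_V$. Saying that $(\mathsf{S},\mu,\eta,\partial)$ is a Cartesian differential comonad on $\mathbb{X}^{op}$ means exactly this, and saying that a natural transformation $\varepsilon_V:\mathsf{S}(V)\to V$ is a $\mathsf{D}$-linear unit for it (on $\mathbb{X}^{op}$) means [du.1] $\varepsilon_V\circ\eta_V=1_V$ and [du.2] $\eta_V\circ\varepsilon_V=\mathsf{S}(\pi_1)\circ\partial_V$. The category $\mathbb{X}^{op}_{\mathsf{S}}$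 is the opposite of the Kleisli category of $\mathsf{S}$ (the coKleisli category of the comonad on $\mathbb{X}^{op}$): objects as in $\mathbb{X}$; a map $A\to B$ is a map $f:B\to\mathsf{S}(A)$ of $\mathbb{X}$; the composite of $f:A\to B$ then $g:B\to C$ is $\mu_A\circ\mathsf{S}(f)\circ g:C\to\mathsf{S}(A)$; the identity is $\eta_A$. Its structure: sums and zeros of maps as in $\mathbb{X}$; product of $A,B$ is $A\times B$ with projections $\eta_{A\times B}\circ\iota_0$ and $\eta_{A\times B}\circ\iota_1$, pairing of $f:A\to\mathsf{S}(C)$ and $g:B\to\mathsf{S}(C)$ is the copairing $[f,g]$; the differential combinator sends $f:B\to\mathsf{S}(A)$ to $\mathsf{D}[f]=\partial_A\circ f:B\to\mathsf{S}(A\times A)$. Cartesian differential categories. A left additive category is a category whose hom-sets are commutative monoids such that $(f+g)\circ x=f\circ x+g\circ x$ and $0\circ x=0$; $f$ is additive if $f\circ(x+y)=f\circ x+f\circ y$ and $f\circ0=0$; a Cartesian left additive category is a left additive category with finite products whose projections are additive. In it put $\iota_0=\langle1,0\rangle$, $\iota_1=\langle0,1\rangle$, $\nabla_A=\pi_0+\pi_1$, $\ell_A=\iota_0\times\iota_1:A\times A\to(A\times A)\times(A\times A)$, $c_A=\langle\pi_0\times\pi_0,\pi_1\times\pi_1\rangle$. A Cartesian differential category is a Cartesian left additive category with operators sending $f:A\to B$ to $\mathsf{D}[f]:A\times A\to B$ such that: [CD.1] $\mathsf{D}[f+g]=\mathsf{D}[f]+\mathsf{D}[g]$, $\mathsf{D}[0]=0$;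 [CD.2] $\mathsf{D}[f]\circ(1_A\times\nabla_A)=\mathsf{D}[f]\circ(1_A\times\pi_0)+\mathsf{D}[f]\circ(1_A\times\pi_1)$, $\mathsf{D}[f]\circ\iota_0=0$; [CD.3] $\mathsf{D}[1_A]=\pi_1$, $\mathsf{D}[\pi_j]=\pi_j\circ\pi_1$; [CD.4] $\mathsf{D}[\langle f,g\rangle]=\langle\mathsf{D}[f],\mathsf{D}[g]\rangle$; [CD.5] $\mathsf{D}[g\circ f]=\mathsf{D}[g]\circ\langle f\circ\pi_0,\mathsf{D}[f]\rangle$; [CD.6] $\mathsf{D}[\mathsf{D}[f]]\circ\ell_A=\mathsf{D}[f]$; [CD.7] $\mathsf{D}[\mathsf{D}[f]]\circ c_A=\mathsf{D}[\mathsf{D}[f]]$. A map $f$ is $\mathsf{D}$-linear if $\mathsf{D}[f]=f\circ\pi_1$; $\mathsf{D}\text{-}\mathsf{lin}[\mathbb{Y}]$ is the subcategory of $\mathbb{Y}$ with the same objects and the $\mathsf{D}$-linear maps. *)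

(* Defs.v *)
From HB Require Import structures.
From mathcomp Require Import all_boot all_order all_algebra.
From mathcomp Require Import boolp finmap monalg.

Set Implicit Arguments.
Unset Strict Implicit.
Unset Printing Implicit Defensive.

Import GRing.Theory.

Record category := Category {
  obj :> Type;
  hom : obj -> obj -> Type;
  idm : forall A, hom A A;
  comp : forall A B C, hom B C -> hom A B -> hom A C;
  comp1m : forall A B (f : hom A B), comp (idm B) f = f;
  compm1 : forall A B (f : hom A B), comp f (idm A) = f;
  compA : forall A B C D (h : hom C D) (g : hom B C) (f : hom A B),
    comp h (comp g f) = comp (comp h g) f }.

Arguments hom {c} A B.
Arguments idm {c} A.
Arguments comp {c A B C} g f.

Declare Scope cat_scope.
Delimit Scope cat_scope with cat.
Local Open Scope cat_scope.
Notation "g \oc f" := (comp g f) (at level 40, left associativity) : cat_scope.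

Definition op_category (X : category) : category :=
  @Category X (fun A B => @hom X B A) (@idm X)
    (fun A B C g f => f \oc g)
    (fun A B f => compm1 f) (fun A B f => comp1m f)
    (fun A B C D h g f => esym (compA f g h)).

Record functor (X Y : category) := Functor {
  fobj :> X -> Y;
  fmap : forall A B, hom A B -> hom (fobj A) (fobj B);
  fmap_id : forall A, fmap (idm A) = idm (fobj A);
  fmap_comp : forall A B C (g : hom B C) (f : hom A B),
    fmap (g \oc f) = fmap g \oc fmap f }.

Arguments fmap {X Y} _ {A B} _.

Definition id_functor (X : category) : functor X X :=
  @Functor X X id (fun A B f => f) (fun A => erefl) (fun A B C g f => erefl).

Section CompFunctor.
Variables (X Y Z : category) (G : functor Y Z) (H : functor X Y).

Lemma comp_functor_id (A : X) : fmap G (fmap H (idm A)) = idm (G (H A)).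
Proof. by rewrite !fmap_id. Qed.

Lemma comp_functor_comp (A B C : X) (g : hom B C) (f : hom A B) :
  fmap G (fmap H (g \oc f)) = fmap G (fmap H g) \oc fmap G (fmap H f).
Proof. by rewrite !fmap_comp. Qed.

Definition comp_functor : functor X Z :=
  @Functor X Z (fun A => G (H A)) (fun A B f => fmap G (fmap H f))
    comp_functor_id comp_functor_comp.
End CompFunctor.

Definition isomorphic_categories (X Y : category) : Prop :=
  exists (G : functor X Y) (H : functor Y X),
    comp_functor H G = id_functor X /\ comp_functor G H = id_functor Y.

Record biprod_category := BiprodCategory {
  bcat :> category;
  hadd : forall A B : bcat, hom A B -> hom A B -> hom A B;
  hzero : forall A B : bcat, hom A B;
  haddA : forall A B (f g h : hom A B), hadd f (hadd g h) = hadd (hadd f g) h;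
  haddC : forall A B (f g : hom A B), hadd f g = hadd g f;
  hadd0 : forall A B (f : hom A B), hadd (hzero A B) f = f;
  comp_haddl : forall A B C (f g : hom B C) (h : hom A B),
    hadd f g \oc h = hadd (f \oc h) (g \oc h);
  comp_haddr : forall A B C (h : hom B C) (f g : hom A B),
    h \oc hadd f g = hadd (h \oc f) (h \oc g);
  comp_hzerol : forall A B C (h : hom A B), hzero B C \oc h = hzero A C;
  comp_hzeror : forall A B C (h : hom B C), h \oc hzero A B = hzero A C;
  zero_obj : bcat;
  zero_objP : idm zero_obj = hzero zero_obj zero_obj;
  bprod : bcat -> bcat -> bcat;
  bpi0 : forall A B, hom (bprod A B) A;
  bpi1 : forall A B, hom (bprod A B) B;
  biota0 : forall A B, hom A (bprod A B);
  biota1 : forall A B, hom B (bprod A B);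
  bpi0_iota0 : forall A B, bpi0 A B \oc biota0 A B = idm A;
  bpi1_iota1 : forall A B, bpi1 A B \oc biota1 A B = idm B;
  bpi0_iota1 : forall A B, bpi0 A B \oc biota1 A B = hzero B A;
  bpi1_iota0 : forall A B, bpi1 A B \oc biota0 A B = hzero A B;
  biotaK : forall A B,
    hadd (biota0 A B \oc bpi0 A B) (biota1 A B \oc bpi1 A B)
      = idm (bprod A B) }.

Arguments hadd {b A B} f g.
Arguments hzero {b} A B.
Arguments zero_obj {b}.
Arguments bprod {b} A B.
Arguments bpi0 {b A B}.
Arguments bpi1 {b A B}.
Arguments biota0 {b A B}.
Arguments biota1 {b A B}.

Section BiprodOps.
Variable X : biprod_category.

Definition bpair (A B C : X) (f : hom C A) (g : hom C B) : hom C (bprod A B) :=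
  hadd (biota0 \oc f) (biota1 \oc g).

Definition bcopair (A B C : X) (f : hom A C) (g : hom B C) :
    hom (bprod A B) C :=
  hadd (f \oc bpi0) (g \oc bpi1).

Definition bprodm (A B C D : X) (f : hom A C) (g : hom B D) :
    hom (bprod A B) (bprod C D) :=
  bpair (f \oc bpi0) (g \oc bpi1).

Definition bdiag (A : X) : hom A (bprod A A) := bpair (idm A) (idm A).

Definition bswap (A : X) :
    hom (bprod (bprod A A) (bprod A A)) (bprod (bprod A A) (bprod A A)) :=
  bpair (bprodm bpi0 bpi0) (bprodm bpi1 bpi1).
End BiprodOps.

Record monad (X : category) := Monad {
  mfun :> functor X X;
  meta : forall A : X, hom A (mfun A);
  mmu : forall A : X, hom (mfun (mfun A)) (mfun A);
  meta_nat : forall (A B : X) (f : hom A B),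
    fmap mfun f \oc meta A = meta B \oc f;
  mmu_nat : forall (A B : X) (f : hom A B),
    fmap mfun f \oc mmu A = mmu B \oc fmap mfun (fmap mfun f);
  mmu_meta : forall A : X, mmu A \oc meta (mfun A) = idm (mfun A);
  mmu_fmap_meta : forall A : X, mmu A \oc fmap mfun (meta A) = idm (mfun A);
  mmu_mmu : forall A : X, mmu A \oc mmu (mfun A) = mmu A \oc fmap mfun (mmu A) }.

Arguments meta {X} m A.
Arguments mmu {X} m A.

Section DifferentialMonad.
Variables (X : biprod_category) (S : monad X).
Variable d : forall V : X, hom (S V) (S (bprod V V)).
Variable e : forall V : X, hom (S V) V.

(* On a monad on X, the axioms of a Cartesian differential comonad on the
   opposite of X, stated in X. *)
Record cartesian_differential_comonad_op : Prop := {
  dc_nat : forall (V W : X) (f : hom V W),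
    fmap S (bprodm f f) \oc d V = d W \oc fmap S f;
  dc1 : forall V : X, fmap S bpi0 \oc d V = hzero (S V) (S V);
  dc2 : forall V : X,
    fmap S (bprodm (idm V) (bdiag V)) \oc d V
    = hadd (fmap S (bprodm (idm V) biota0)) (fmap S (bprodm (idm V) biota1))
        \oc d V;
  dc3 : forall V : X, d V \oc meta S V = meta S (bprod V V) \oc biota1;
  dc4 : forall V : X,
    d V \oc mmu S V
    = mmu S (bprod V V) \oc fmap S (bcopair (fmap S biota0) (d V)) \oc d (S V);
  dc5 : forall V : X,
    fmap S (bprodm bpi0 bpi1) \oc d (bprod V V) \oc d V = d V;
  dc6 : forall V : X,
    fmap S (bswap V) \oc d (bprod V V) \oc d V = d (bprod V V) \oc d V }.

Record D_linear_unit_op : Prop := {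
  du_nat : forall (V W : X) (f : hom V W), f \oc e V = e W \oc fmap S f;
  du1 : forall V : X, e V \oc meta S V = idm V;
  du2 : forall V : X, meta S V \oc e V = fmap S bpi1 \oc d V }.
End DifferentialMonad.

Record clac_ops (Y : category) := ClacOps {
  ladd : forall A B : Y, hom A B -> hom A B -> hom A B;
  lzero : forall A B : Y, hom A B;
  lterm : Y;
  lprod : Y -> Y -> Y;
  lpi0 : forall A B, hom (lprod A B) A;
  lpi1 : forall A B, hom (lprod A B) B;
  lpair : forall A B C, hom C A -> hom C B -> hom C (lprod A B) }.

Arguments ladd {Y} c {A B} f g.
Arguments lzero {Y} c A B.
Arguments lterm {Y} c.
Arguments lprod {Y} c A B.
Arguments lpi0 {Y} c {A B}.
Arguments lpi1 {Y} c {A B}.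
Arguments lpair {Y} c {A B C} f g.

Section CDC.
Variables (Y : category) (o : clac_ops Y).
Local Notation "f \+c g" := (ladd o f g) (at level 50, left associativity).
Local Notation "0" := (lzero o _ _).
Local Notation "A \x B" := (lprod o A B) (at level 40, left associativity).
Local Notation pi0 := (lpi0 o).
Local Notation pi1 := (lpi1 o).
Local Notation "'<|' f , g '|>'" := (lpair o f g) (f at level 99, g at level 99).

Definition additive_map (A B : Y) (f : hom A B) : Prop :=
  (forall (C : Y) (x y : hom C A), f \oc (x \+c y) = f \oc x \+c f \oc y)
  /\ (forall C : Y, f \oc (0 : hom C A) = 0).

Record is_clac : Prop := {
  laddA : forall (A B : Y) (f g h : hom A B), f \+c (g \+c h) = f \+c g \+c h;
  laddC : forall (A B : Y) (f g : hom A B), f \+c g = g \+c f;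
  ladd0 : forall (A B : Y) (f : hom A B), 0 \+c f = f;
  ladd_comp : forall (A B C : Y) (f g : hom B C) (x : hom A B),
    (f \+c g) \oc x = f \oc x \+c g \oc x;
  lzero_comp : forall (A B C : Y) (x : hom A B), (0 : hom B C) \oc x = 0;
  lterm_uniq : forall A : Y, exists t : hom A (lterm o), forall t', t' = t;
  lpair0 : forall (A B C : Y) (f : hom C A) (g : hom C B),
    pi0 \oc <|f, g|> = f;
  lpair1 : forall (A B C : Y) (f : hom C A) (g : hom C B),
    pi1 \oc <|f, g|> = g;
  lpair_uniq : forall (A B C : Y) (f : hom C A) (g : hom C B)
      (h : hom C (A \x B)),
    pi0 \oc h = f -> pi1 \oc h = g -> h = <|f, g|>;
  lpi0_additive : forall A B : Y, additive_map (@lpi0 Y o A B);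
  lpi1_additive : forall A B : Y, additive_map (@lpi1 Y o A B) }.

Definition lprodm (A B C E : Y) (f : hom A C) (g : hom B E) :
    hom (A \x B) (C \x E) := <|f \oc pi0, g \oc pi1|>.
Definition liota0 (A : Y) : hom A (A \x A) := <|idm A, 0|>.
Definition liota1 (A : Y) : hom A (A \x A) := <|0, idm A|>.
Definition lnabla (A : Y) : hom (A \x A) A := pi0 \+c pi1.
Definition lell (A : Y) : hom (A \x A) ((A \x A) \x (A \x A)) :=
  lprodm (liota0 A) (liota1 A).
Definition lswap (A : Y) :
    hom ((A \x A) \x (A \x A)) ((A \x A) \x (A \x A)) :=
  <|lprodm pi0 pi0, lprodm pi1 pi1|>.

Variable D : forall A B : Y, hom A B -> hom (A \x A) B.

Record is_cdc : Prop := {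
  cdc_clac : is_clac;
  CD1_add : forall (A B : Y) (f g : hom A B), D (f \+c g) = D f \+c D g;
  CD1_zero : forall A B : Y, D (0 : hom A B) = 0;
  CD2_add : forall (A B : Y) (f : hom A B),
    D f \oc lprodm (idm A) (lnabla A)
    = D f \oc lprodm (idm A) pi0 \+c D f \oc lprodm (idm A) pi1;
  CD2_zero : forall (A B : Y) (f : hom A B), D f \oc liota0 A = 0;
  CD3_id : forall A : Y, D (idm A) = pi1;
  CD3_pi0 : forall A B : Y, D (@lpi0 Y o A B) = pi0 \oc pi1;
  CD3_pi1 : forall A B : Y, D (@lpi1 Y o A B) = pi1 \oc pi1;
  CD4 : forall (A B C : Y) (f : hom C A) (g : hom C B),
    D <|f, g|> = <|D f, D g|>;
  CD5 : forall (A B C : Y) (g : hom B C) (f : hom A B),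
    D (g \oc f) = D g \oc <|f \oc pi0, D f|>;
  CD6 : forall (A B : Y) (f : hom A B), D (D f) \oc lell A = D f;
  CD7 : forall (A B : Y) (f : hom A B), D (D f) \oc lswap A = D (D f) }.

Definition D_linear (A B : Y) (f : hom A B) : Prop := D f = f \oc pi1.

Hypothesis Ycdc : is_cdc.

Lemma D_linear_id (A : Y) : D_linear (idm A).
Proof. by rewrite /D_linear (CD3_id Ycdc) comp1m. Qed.

Lemma D_linear_comp (A B C : Y) (g : hom B C) (f : hom A B) :
  D_linear g -> D_linear f -> D_linear (g \oc f).
Proof.
rewrite /D_linear => lg lf; rewrite (CD5 Ycdc) lg lf -compA.
by rewrite (lpair1 (cdc_clac Ycdc)) compA.
Qed.

Definition Dlin_hom (A B : Y) := {f : hom A B | D_linear f}.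

Lemma Dlin_hom_eq (A B : Y) (f g : Dlin_hom A B) : sval f = sval g -> f = g.
Proof. by case: f g => [f lf] [g lg] /= fg; apply: eq_exist. Qed.

Definition Dlin_id (A : Y) : Dlin_hom A A := exist _ (idm A) (D_linear_id A).
Definition Dlin_comp (A B C : Y) (g : Dlin_hom B C) (f : Dlin_hom A B) :
    Dlin_hom A C :=
  exist _ (sval g \oc sval f) (D_linear_comp (svalP g) (svalP f)).

Definition Dlin : category.
Proof.
apply: (@Category Y Dlin_hom Dlin_id Dlin_comp).
- by move=> A B f; apply: Dlin_hom_eq; apply: comp1m.
- by move=> A B f; apply: Dlin_hom_eq; apply: compm1.
- by move=> A B C E h g f; apply: Dlin_hom_eq; apply: compA.
Defined.
End CDC.

Section KleisliOp.
Variables (X : biprod_category) (S : monad X).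

Definition klop_hom (A B : X) : Type := hom B (S A).
Definition klop_id (A : X) : klop_hom A A := meta S A.
Definition klop_comp (A B C : X) (g : klop_hom B C) (f : klop_hom A B) :
    klop_hom A C :=
  mmu S A \oc fmap S f \oc g.

Definition kleisli_op : category.
Proof.
apply: (@Category X klop_hom klop_id klop_comp).
- move=> A B f; rewrite /klop_comp /klop_id /klop_hom in f *.
  by rewrite -compA meta_nat compA mmu_meta comp1m.
- move=> A B f; rewrite /klop_comp /klop_id.
  by rewrite mmu_fmap_meta comp1m.
- move=> A B C E h g f; rewrite /klop_comp /klop_hom in f g h *.
  rewrite !fmap_comp !compA; congr (_ \oc _); rewrite -mmu_mmu.
  by rewrite -!compA; congr (_ \oc _); rewrite !compA mmu_nat.
Defined.

Definition kleisli_op_clac : clac_ops kleisli_op :=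
  @ClacOps kleisli_op
    (fun A B f g => @hadd X B (S A) f g)
    (fun A B => @hzero X B (S A))
    (@zero_obj X)
    (fun A B => @bprod X A B)
    (fun A B => meta S (bprod A B) \oc biota0)
    (fun A B => meta S (bprod A B) \oc biota1)
    (fun A B C f g => @bcopair X A B (S C) f g).

Variable d : forall V : X, hom (S V) (S (bprod V V)).

Definition kleisli_op_D (A B : kleisli_op) (f : hom A B) :
    hom (lprod kleisli_op_clac A A) B :=
  @comp X _ _ _ (d A) f.
End KleisliOp.

Local Open Scope ring_scope.

Lemma linear_ext (R : pzRingType) (U V : lmodType R) (f g : {linear U -> V}) :
  f =1 g -> f = g.
Proof.
move=> /funext; case: f g => [f [[af] [sf]]] [g [[ag] [sg]]] /= fg.
case: _ / fg in ag sg *.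
by rewrite (Prop_irrelevance af ag) (Prop_irrelevance sf sg).
Qed.

Definition mk_linear (R : pzRingType) (U V : lmodType R) (f : U -> V)
    (lf : linear f) : {linear U -> V} :=
  HB.pack f (GRing.isLinear.Build R U V _ f lf).

Section Vec.
Variable F : fieldType.

Definition vec_category : category.
Proof.
apply: (@Category (lmodType F) (fun U V => {linear U -> V})
  (fun U => idfun : {linear U -> U})
  (fun U V W g f => (g \o f) : {linear U -> W})).
- by move=> U V f; apply: linear_ext.
- by move=> U V f; apply: linear_ext.
- by move=> U V W Z h g f; apply: linear_ext.
Defined.

Lemma inl_linear (U V : lmodType F) : linear (fun u : U => (u, 0 : V)).
Proof. by move=> a u v; congr pair; rewrite /= scaler0 addr0. Qed.

Lemma inr_linear (U V : lmodType F) : linear (fun v : V => (0 : U, v)).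
Proof. by move=> a u v; congr pair; rewrite /= scaler0 addr0. Qed.

Definition VEC : biprod_category.
Proof.
apply: (@BiprodCategory vec_category
  (fun (U V : lmodType F) (f g : {linear U -> V}) =>
     (f \+ g) : {linear U -> V})
  (fun U V : lmodType F => \0 : {linear U -> V})
  _ _ _ _ _ _ _
  ('rV[F]_0 : lmodType F) _
  (fun U V : lmodType F => (U * V)%type : lmodType F)
  (fun U V : lmodType F => fst : {linear (U * V)%type -> U})
  (fun U V : lmodType F => snd : {linear (U * V)%type -> V})
  (fun U V : lmodType F => mk_linear (@inl_linear U V))
  (fun U V : lmodType F => mk_linear (@inr_linear U V))).
- by move=> U V f g h; apply: linear_ext => x /=; rewrite addrA.
- by move=> U V f g; apply: linear_ext => x /=; rewrite addrC.
- by move=> U V f; apply: linear_ext => x /=; rewrite add0r.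
- by move=> U V W f g h; apply: linear_ext.
- by move=> U V W h f g; apply: linear_ext => x /=; rewrite linearD.
- by move=> U V W h; apply: linear_ext.
- by move=> U V W h; apply: linear_ext => x /=; rewrite linear0.
- by apply: linear_ext => x; apply/rowP; case.
- by move=> U V; apply: linear_ext.
- by move=> U V; apply: linear_ext.
- by move=> U V; apply: linear_ext.
- by move=> U V; apply: linear_ext.
- move=> U V; apply: linear_ext => -[u v] /=.
  by congr pair; rewrite /= ?addr0 ?add0r.
Defined.
End Vec.

Section FreeLift.
Variables (F : fieldType) (K : choiceType) (W : lmodType F) (phi : K -> W).

Definition free_lift_fun (g : {malg F[K]}) : W :=
  \sum_(k <- msupp g) mcoeff k g *: phi k.

Lemma free_liftw (g : {malg F[K]}) (d : {fset K}) :
  (msupp g `<=` d)%fset -> free_lift_fun g = \sum_(k <- d) mcoeff k g *: phi k.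
Proof.
move=> gd; rewrite /free_lift_fun; apply: big_fset_incl => // k kd kg.
by rewrite mcoeff_outdom // scale0r.
Qed.

Lemma free_lift_linear : linear free_lift_fun.
Proof.
move=> a x y; pose d := (msupp x `|` msupp y)%fset.
have xd : (msupp x `<=` d)%fset by apply: fsubsetUl.
have yd : (msupp y `<=` d)%fset by apply: fsubsetUr.
have zd : (msupp (a *: x + y) `<=` d)%fset.
  apply: fsubset_trans (msuppD_le _ _) _; apply: fsetSU.
  exact: msuppZ_le.
rewrite (free_liftw xd) (free_liftw yd) (free_liftw zd) scaler_sumr -big_split.
apply: eq_bigr => k _ /=.
by rewrite mcoeffD mcoeffZ scalerDl scalerA.
Qed.

Definition free_lift : {linear {malg F[K]} -> W} := mk_linear free_lift_linear.

Lemma free_liftU k : free_lift (mkmalgU k 1) = phi k.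
Proof.
rewrite /= (free_liftw (d := [fset k]%fset)); last exact: msuppU_le.
by rewrite big_seq_fset1 mcoeffUU scale1r.
Qed.
End FreeLift.

Section Tensor.
Variable F : fieldType.

(* The nonempty word v :: s, standing for the pure tensor of its letters, is
   represented by the pair (v, s). *)
Definition word (V : lmodType F) : Type := (V * seq V)%type.
HB.instance Definition _ V := Choice.on (word V).

Section Relations.
Variable V : lmodType F.

Definition word_gen (v : V) (s : seq V) : {malg F[word V]} :=
  mkmalgU ((v, s) : word V) 1.

(* The subspace spanned by the relations making words linear in each letter. *)
Inductive multilinear_rel : {malg F[word V]} -> Prop :=
| mrel_zero : multilinear_rel 0
| mrel_lin a x y :
    multilinear_rel x -> multilinear_rel y -> multilinear_rel (a *: x + y)
| mrel_head a u v s :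
    multilinear_rel
      (word_gen (a *: u + v) s - (a *: word_gen u s + word_gen v s))
| mrel_tail a u v x s t :
    multilinear_rel
      (word_gen x (s ++ (a *: u + v) :: t)
       - (a *: word_gen x (s ++ u :: t) + word_gen x (s ++ v :: t))).

Definition mrel_pred : {pred {malg F[word V]}} :=
  fun x => `[< multilinear_rel x >].

Lemma mrel_submod : submod_closed mrel_pred.
Proof.
split; first by apply/asboolP; exact: mrel_zero.
by move=> a x y /asboolP x0 /asboolP y0; apply/asboolP; exact: mrel_lin.
Qed.

HB.instance Definition _ := GRing.isSubmodClosed.Build F _ mrel_pred mrel_submod.
End Relations.

(* Since the relations are homogeneous for the length of words, the quotient
   of the free vector space on the words of length >= 1 is the direct sum
   of the tensor powers of V of exponent >= 1. *)
Definition Zin (V : lmodType F) : Type := Quotient.quot (@mrel_pred V).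
HB.instance Definition _ V := GRing.Zmodule.on (Zin V).

Section ZinModule.
Variable V : lmodType F.
Implicit Types x y : Zin V.

Definition zin_pi (g : {malg F[word V]}) : Zin V := \pi_(Zin V)%qT g.
Local Notation pi := zin_pi.

Lemma zin_piK x : pi (repr x) = x.
Proof. exact: reprK. Qed.

Lemma zin_piP (g h : {malg F[word V]}) : multilinear_rel (g - h) -> pi g = pi h.
Proof.
move=> gh; apply/eqP; rewrite -Quotient.idealrBE unfold_in.
exact/asboolP.
Qed.

Lemma zin_pi_rel (g : {malg F[word V]}) : multilinear_rel (repr (pi g) - g).
Proof.
have : (repr (pi g) - g) \in @mrel_pred V.
  by rewrite Quotient.idealrBE; apply/eqP; exact: zin_piK.
by rewrite unfold_in => /asboolP.
Qed.

Definition zin_scale (a : F) (x : Zin V) : Zin V := pi (a *: repr x).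

Lemma mrel_scale a (g : {malg F[word V]}) :
  multilinear_rel g -> multilinear_rel (a *: g).
Proof. by move=> g0; rewrite -[_ *: g]addr0; apply: mrel_lin => //; apply: mrel_zero. Qed.

Lemma zin_piZ a (g : {malg F[word V]}) : pi (a *: g) = zin_scale a (pi g).
Proof.
apply/esym/zin_piP; rewrite -scalerBr; apply: mrel_scale.
exact: zin_pi_rel.
Qed.

Lemma zin_piD (g h : {malg F[word V]}) : pi (g + h) = pi g + pi h.
Proof. exact: raddfD. Qed.

Lemma zin_scaleA a b x : zin_scale a (zin_scale b x) = zin_scale (a * b) x.
Proof. by rewrite -[x]zin_piK -!zin_piZ scalerA. Qed.

Lemma zin_scale1 : left_id 1 zin_scale.
Proof. by move=> x; rewrite -[x]zin_piK -!zin_piZ scale1r. Qed.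

Lemma zin_scaleDr : right_distributive zin_scale +%R.
Proof.
move=> a x y; rewrite -[x]zin_piK -[y]zin_piK.
by rewrite -zin_piD -!zin_piZ scalerDr zin_piD.
Qed.

Lemma zin_scaleDl x : {morph zin_scale^~ x : a b / a + b}.
Proof. by move=> a b; rewrite -[x]zin_piK -!zin_piZ scalerDl zin_piD. Qed.

HB.instance Definition _ := GRing.Zmodule_isLmodule.Build F (Zin V)
  zin_scaleA zin_scale1 zin_scaleDr zin_scaleDl.

Lemma zin_pi_linear : linear pi.
Proof. by move=> a g h; rewrite zin_piD zin_piZ. Qed.

Fact tens_key : unit. Proof. by []. Qed.

(* The pure tensor of the letters of v :: s; locked, like zin_lift below,
   because comparing two of them by computation is not practical. *)
Definition tens : V -> seq V -> Zin V :=
  locked_with tens_key (fun v s => pi (word_gen v s)).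

Lemma tensE v s : tens v s = pi (word_gen v s).
Proof. by rewrite /tens unlock. Qed.

Record multilinear (W : lmodType F) (phi : V -> seq V -> W) : Prop := {
  mlin_head : forall a u v s,
    phi (a *: u + v) s = a *: phi u s + phi v s;
  mlin_tail : forall a u v w s t,
    phi w (s ++ (a *: u + v) :: t)
    = a *: phi w (s ++ u :: t) + phi w (s ++ v :: t) }.

Lemma tens_multilinear : multilinear tens.
Proof.
split=> *; rewrite !tensE -zin_pi_linear; apply: zin_piP.
- exact: mrel_head.
- exact: mrel_tail.
Qed.

Section Lift.
Variables (W : lmodType F) (phi : V -> seq V -> W).
Hypothesis mphi : multilinear phi.

Let fphi := free_lift (fun w : word V => phi w.1 w.2).

Lemma zin_lift_rel (g : {malg F[word V]}) : multilinear_rel g -> fphi g = 0.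
Proof.
elim=> [|a x y _ x0 _ y0|a u v s|a u v x s t].
- exact: linear0.
- by rewrite linearP x0 y0 scaler0 addr0.
- by rewrite linearB linearP !free_liftU mlin_head // subrr.
- by rewrite linearB linearP !free_liftU mlin_tail // subrr.
Qed.

Lemma zin_lift_pi (g : {malg F[word V]}) : fphi (repr (pi g)) = fphi g.
Proof.
apply/eqP; rewrite -subr_eq0 -linearB; apply/eqP/zin_lift_rel.
exact: zin_pi_rel.
Qed.

Lemma zin_lift_linear : linear (fun x : Zin V => fphi (repr x)).
Proof.
move=> a x y; rewrite -[x]zin_piK -[y]zin_piK -zin_pi_linear.
by rewrite !zin_lift_pi linearP.
Qed.

Fact zin_lift_key : unit. Proof. by []. Qed.

(* The linear map given by phi on pure tensors. *)
Definition zin_lift : {linear Zin V -> W} :=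
  locked_with zin_lift_key (mk_linear zin_lift_linear).

Lemma zin_lift_tens v s : zin_lift (tens v s) = phi v s.
Proof.
rewrite tensE /zin_lift [locked_with _ _]unlock.
exact: etrans (zin_lift_pi _) (free_liftU _ _).
Qed.
End Lift.

Lemma zin_ind (P : Zin V -> Prop) :
  P 0 -> (forall a v s x, P x -> P (a *: tens v s + x)) -> forall x, P x.
Proof.
move=> P0 PD x; rewrite -[x]zin_piK (monalgE (repr x)).
elim: (X in \big[_/_]_(i <- X) _) => [|[v s] r IH]; rewrite ?big_nil ?big_cons.
  by have /= -> := linear0 (mk_linear zin_pi_linear).
rewrite zin_piD; set c := mcoeff _ _.
have -> : mkmalgU ((v, s) : word V) c = c *: word_gen v s.
  by apply/malgP => k; rewrite mcoeffZ !mcoeffU mulrnAr mulr1.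
by rewrite zin_piZ -tensE; apply: PD.
Qed.

Lemma zin_ext (W : lmodType F) (f g : {linear Zin V -> W}) :
  (forall v s, f (tens v s) = g (tens v s)) -> f = g.
Proof.
move=> fg; apply: linear_ext => x; elim/zin_ind: x => [|a v s x fgx].
  by rewrite !linear0.
by rewrite !linearP fg fgx.
Qed.
End ZinModule.

(* All the interleavings of s and t, with multiplicity. *)
Fixpoint shuffles (T : Type) (s : seq T) : seq T -> seq (seq T) :=
  fix shuffles_s (t : seq T) : seq (seq T) :=
    match s, t with
    | [::], _ => [:: t]
    | _, [::] => [:: s]
    | x :: s', y :: t' =>
        [seq x :: w | w <- shuffles s' t] ++ [seq y :: w | w <- shuffles_s t']
    end.

Section Shuffles.
Variables (T : Type) (W : nmodType).
Implicit Type G : seq T -> W.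

Definition shsum G s t : W := \sum_(w <- shuffles s t) G w.

Lemma shsum0s G t : shsum G [::] t = G t.
Proof. by rewrite /shsum; case: t => [|y t]; rewrite big_seq1. Qed.

Lemma shsums0 G s : shsum G s [::] = G s.
Proof. by rewrite /shsum; case: s => [|y t]; rewrite big_seq1. Qed.

Lemma shsum_cons G x s y t :
  shsum G (x :: s) (y :: t)
  = shsum (fun w => G (x :: w)) s (y :: t)
    + shsum (fun w => G (y :: w)) (x :: s) t.
Proof. by rewrite {1}/shsum /= big_cat !big_map. Qed.

Lemma eq_shsum G G' s t : G =1 G' -> shsum G s t = shsum G' s t.
Proof. by move=> GG'; apply: eq_bigr. Qed.

Lemma shsumD G G' s t :
  shsum (fun w => G w + G' w) s t = shsum G s t + shsum G' s t.
Proof. exact: big_split. Qed.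

Lemma shsum_consl G x y s t u :
  shsum (fun w => shsum G (x :: w) (y :: u)) s t
  = shsum (fun w => shsum (fun v => G (x :: v)) w (y :: u)) s t
    + shsum (fun w => shsum (fun v => G (y :: v)) (x :: w) u) s t.
Proof. by rewrite -shsumD; apply: eq_shsum => w; rewrite shsum_cons. Qed.

Lemma shsum_consr G x y s t u :
  shsum (fun w => shsum G (x :: u) (y :: w)) s t
  = shsum (fun w => shsum (fun v => G (x :: v)) u (y :: w)) s t
    + shsum (fun w => shsum (fun v => G (y :: v)) (x :: u) w) s t.
Proof. by rewrite -shsumD; apply: eq_shsum => w; rewrite shsum_cons. Qed.

Lemma shsumC G s t : shsum G s t = shsum G t s.
Proof.
elim: s G t => [|x s IHs] G t; first by rewrite shsum0s shsums0.
elim: t G => [|y t IHt] G; first by rewrite shsum0s shsums0.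
by rewrite !shsum_cons IHs IHt addrC.
Qed.

Lemma shsumA G s t u :
  shsum (fun w => shsum G w u) s t = shsum (fun w => shsum G s w) t u.
Proof.
move: {2}(size s + size t + size u).+1 (leqnn (size s + size t + size u).+1).
move=> n; elim: n G s t u => [//|n IH] G s t u ltn.
case: s ltn => [|x s] ltn.
  by rewrite shsum0s; apply: eq_shsum => w; rewrite shsum0s.
case: t ltn => [|y t] ltn; first by rewrite shsums0 shsum0s.
case: u ltn => [|z u] ltn.
  by rewrite shsums0; apply: eq_shsum => w; rewrite shsums0.
have L : shsum (fun w => shsum G w (z :: u)) (x :: s) (y :: t)
  = shsum (fun w => shsum (fun v => G (x :: v)) w (z :: u)) s (y :: t)
    + shsum (fun w => shsum (fun v => G (y :: v)) w (z :: u)) (x :: s) t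
    + shsum (fun w => shsum (fun v => G (z :: v)) w u) (x :: s) (y :: t).
  rewrite (shsum_cons _ x s y t) !shsum_consl addrACA.
  by rewrite (shsum_cons _ x s y t).
have R : shsum (fun w => shsum G (x :: s) w) (y :: t) (z :: u)
  = shsum (fun w => shsum (fun v => G (x :: v)) s w) (y :: t) (z :: u)
    + shsum (fun w => shsum (fun v => G (y :: v)) (x :: s) w) t (z :: u)
    + shsum (fun w => shsum (fun v => G (z :: v)) (x :: s) w) (y :: t) u.
  rewrite (shsum_cons _ y t z u) !shsum_consr addrACA.
  by rewrite (shsum_cons _ y t z u) addrA.
by rewrite L R; congr (_ + _ + _); apply: IH; move: ltn; rewrite /= !(addnS, addSn).
Qed.
End Shuffles.

Section Zinbiel.
Variable V : lmodType F.

Definition slin (W : lmodType F) (G : seq V -> W) : Prop :=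
  forall a u v s t,
    G (s ++ (a *: u + v) :: t) = a *: G (s ++ u :: t) + G (s ++ v :: t).

Lemma slin_cons (W : lmodType F) (G : seq V -> W) x :
  slin G -> slin (fun w => G (x :: w)).
Proof. by move=> lG a u v s t; exact: (lG a u v (x :: s) t). Qed.

Lemma shsumZD (W : lmodType F) (G G' : seq V -> W) a s t :
  shsum (fun w => a *: G w + G' w) s t = a *: shsum G s t + shsum G' s t.
Proof. by rewrite shsumD; congr (_ + _); rewrite /shsum scaler_sumr. Qed.

Lemma shsum_linr (W : lmodType F) (G : seq V -> W) s :
  slin G -> slin (shsum G s).
Proof.
elim: s G => [|x s IHs] G lG a u v s1 t; first by rewrite !shsum0s lG.
elim: s1 G lG => [|y s1 IH1] G lG /=.
  rewrite !shsum_cons (IHs _ (slin_cons _ lG) a u v [::] t).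
  have -> : shsum (fun w => G ((a *: u + v) :: w)) (x :: s) t
      = shsum (fun w => a *: G (u :: w) + G (v :: w)) (x :: s) t.
    by apply: eq_shsum => w; exact: (lG a u v [::] w).
  by rewrite shsumZD scalerDr addrACA.
rewrite !shsum_cons (IHs _ (slin_cons _ lG) a u v (y :: s1) t).
by rewrite (IH1 _ (slin_cons _ lG)) scalerDr addrACA.
Qed.

Lemma shsum_linl (W : lmodType F) (G : seq V -> W) t :
  slin G -> slin (fun s => shsum G s t).
Proof. by move=> lG a u v s1 s2; rewrite !(shsumC _ _ t) shsum_linr. Qed.

Lemma multilinear_slin (W : lmodType F) (phi : V -> seq V -> W) v :
  multilinear phi -> slin (phi v).
Proof. by move=> mphi a u w s t; exact: mlin_tail. Qed.

(* (v :: s) < (w :: t) *)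
Definition zinb_word (v : V) (s : seq V) (w : V) (t : seq V) : Zin V :=
  \sum_(r <- shuffles s (w :: t)) tens v r.

Lemma zinb_word_multir v s : multilinear (zinb_word v s).
Proof.
have lG := shsum_linr s (multilinear_slin v (tens_multilinear V)).
split=> [a u w t|a u w x t1 t2].
- exact: (lG a u w [::] t).
- exact: (lG a u w (x :: t1) t2).
Qed.

Lemma zinb_word_multil w t : multilinear (fun v s => zinb_word v s w t).
Proof.
split=> [a u v s|a u v x s1 s2].
  rewrite /zinb_word scaler_sumr -big_split; apply: eq_bigr => r _.
  by rewrite (mlin_head (tens_multilinear V)).
exact: (shsum_linl (w :: t) (multilinear_slin x (tens_multilinear V))).
Qed.

Lemma zinb_multil (y : Zin V) :
  multilinear (fun v s => zin_lift (zinb_word_multir v s) y).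
Proof.
split=> *; elim/zin_ind: y => [|b w r y IH];
  rewrite ?linear0 ?scaler0 ?addr0 // !linearP IH !zin_lift_tens.
  rewrite (mlin_head (zinb_word_multil w r)) !scalerDr !scalerA.
  by rewrite addrACA (mulrC b).
rewrite (mlin_tail (zinb_word_multil w r)) !scalerDr !scalerA.
by rewrite addrACA (mulrC b).
Qed.

(* The Zinbiel product x < y. *)
Definition zinb (x y : Zin V) : Zin V := zin_lift (zinb_multil y) x.

Lemma zinb_tens v s w t :
  zinb (tens v s) (tens w t) = \sum_(r <- shuffles s (w :: t)) tens v r.
Proof. by rewrite /zinb !zin_lift_tens. Qed.

Lemma zinb_tens_sum v s x :
  zinb (tens v s) x = zin_lift (zinb_word_multir v s) x.
Proof. by rewrite /zinb zin_lift_tens. Qed.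

Lemma zinb_linl y : linear (zinb^~ y).
Proof. by move=> a u v; rewrite /zinb linearP. Qed.

Lemma zinb_linr x : linear (zinb x).
Proof.
move=> a u v; elim/zin_ind: x => [|b w r x IH].
  by rewrite /zinb !linear0 addr0.
rewrite !zinb_linl IH !zinb_tens_sum.
have -> : zin_lift (zinb_word_multir w r) (a *: u + v)
    = a *: zin_lift (zinb_word_multir w r) u + zin_lift (zinb_word_multir w r) v.
  exact: linearP.
by rewrite !scalerDr !scalerA [LHS]addrACA (mulrC b).
Qed.

Lemma zinb0l y : zinb 0 y = 0.
Proof. exact: (linear0 (mk_linear (zinb_linl y))). Qed.

Lemma zinb0r x : zinb x 0 = 0.
Proof. exact: (linear0 (mk_linear (zinb_linr x))). Qed.

Lemma zinbDl x y z : zinb (x + y) z = zinb x z + zinb y z.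
Proof. exact: (linearD (mk_linear (zinb_linl z))). Qed.

Lemma zinbDr x y z : zinb x (y + z) = zinb x y + zinb x z.
Proof. exact: (linearD (mk_linear (zinb_linr x))). Qed.

Lemma zinbZl a x z : zinb (a *: x) z = a *: zinb x z.
Proof. exact: (linearZ_LR (mk_linear (zinb_linl z))). Qed.

Lemma zinbZr a x z : zinb x (a *: z) = a *: zinb x z.
Proof. exact: (linearZ_LR (mk_linear (zinb_linr x))). Qed.

Lemma zinb_suml (I : Type) (r : seq I) (f : I -> Zin V) y :
  zinb (\sum_(i <- r) f i) y = \sum_(i <- r) zinb (f i) y.
Proof. exact: (linear_sum (mk_linear (zinb_linl y))). Qed.

Lemma zinb_sumr (I : Type) (r : seq I) (f : I -> Zin V) y :
  zinb y (\sum_(i <- r) f i) = \sum_(i <- r) zinb y (f i).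
Proof. exact: (linear_sum (mk_linear (zinb_linr y))). Qed.

Lemma zinb_zinbiel x y z : zinb (zinb x y) z = zinb x (zinb y z) + zinb x (zinb z y).
Proof.
elim/zin_ind: x => [|a v s x IH]; first by rewrite !zinb0l addr0.
rewrite !(zinbDl, zinbZl) IH [RHS]addrACA; congr (_ + _).
rewrite -scalerDr; congr (_ *: _) => {x IH}.
elim/zin_ind: y => [|b w t y IH]; first by rewrite !(zinb0l, zinb0r) addr0.
rewrite !(zinbDl, zinbZl, zinbDr, zinbZr) IH [RHS]addrACA; congr (_ + _).
rewrite -scalerDr; congr (_ *: _) => {y IH}.
elim/zin_ind: z => [|c u r z IH]; first by rewrite !(zinb0l, zinb0r) addr0.
rewrite !(zinbDl, zinbZl, zinbDr, zinbZr) IH [RHS]addrACA; congr (_ + _).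
rewrite -scalerDr; congr (_ *: _) => {z IH}.
rewrite !zinb_tens zinb_suml !zinb_sumr.
under eq_bigr do rewrite zinb_tens.
under [X in _ = X + _]eq_bigr do rewrite zinb_tens.
under [X in _ = _ + X]eq_bigr do rewrite zinb_tens.
have := shsumA (tens v) s (w :: t) (u :: r); rewrite shsum_cons (shsumC _ (w :: t)).
by rewrite /shsum.
Qed.
End Zinbiel.

Section ZinMonad.

Lemma zin_map_multi (V W : lmodType F) (f : {linear V -> W}) :
  multilinear (fun v s => tens (f v) (map f s)).
Proof.
split=> [a u v s|a u v x s t]; first by rewrite linearP (mlin_head (tens_multilinear W)).
by rewrite !map_cat /= linearP (mlin_tail (tens_multilinear W)).
Qed.

Definition zin_map (V W : lmodType F) (f : {linear V -> W}) :
    {linear Zin V -> Zin W} :=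
  zin_lift (zin_map_multi f).

Lemma zin_eta_linear (V : lmodType F) : linear (fun v : V => tens v [::]).
Proof. by move=> a u v; rewrite (mlin_head (tens_multilinear V)). Qed.

Definition zin_eta (V : lmodType F) : {linear V -> Zin V} :=
  mk_linear (@zin_eta_linear V).

(* x < (s_1 < (... < s_n)) *)
Fixpoint zinb_iter (V : lmodType F) (x : Zin V) (s : seq (Zin V)) : Zin V :=
  if s is y :: s' then zinb x (zinb_iter y s') else x.

Lemma zin_mu_multi (V : lmodType F) : multilinear (@zinb_iter V).
Proof.
split=> [a u v [|y s]|a u v x s t] //=; first by rewrite zinb_linl.
elim: s x => [|y s IH] x /=; last by rewrite IH zinb_linr.
by case: t => [|y t] /=; rewrite ?zinb_linl zinb_linr.
Qed.

Definition zin_mu (V : lmodType F) : {linear Zin (Zin V) -> Zin V} :=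
  zin_lift (zin_mu_multi V).

Lemma zin_map_tens (V W : lmodType F) (f : {linear V -> W}) v s :
  zin_map f (tens v s) = tens (f v) (map f s).
Proof. exact: zin_lift_tens. Qed.

Lemma zin_mu_tens (V : lmodType F) (x : Zin V) s :
  zin_mu V (tens x s) = zinb_iter x s.
Proof. exact: zin_lift_tens. Qed.

Lemma shsum_map (T T' : Type) (W : nmodType) (f : T -> T') (G : seq T' -> W) s t :
  shsum G (map f s) (map f t) = shsum (fun w => G (map f w)) s t.
Proof.
elim: s G t => [|x s IHs] G t; first by rewrite !shsum0s.
elim: t G => [|y t IHt] G; first by rewrite !shsums0.
by rewrite /= !shsum_cons (IHs _ (y :: t)) (IHt (fun w => G (f y :: w))).
Qed.

Lemma zin_map_zinb (V W : lmodType F) (f : {linear V -> W}) x y :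
  zin_map f (zinb x y) = zinb (zin_map f x) (zin_map f y).
Proof.
elim/zin_ind: x => [|a v s x IH]; first by rewrite !(zinb0l, linear0).
rewrite !(zinbDl, zinbZl, linearP) IH /=; congr (_ *: _ + _) => {x IH}.
elim/zin_ind: y => [|b w t y IH]; first by rewrite !(zinb0r, linear0).
rewrite !(zinbDr, zinbZr, linearP) IH /=; congr (_ *: _ + _) => {y IH}.
rewrite !zin_map_tens !zinb_tens linear_sum.
under eq_bigr do rewrite zin_map_tens.
exact/esym/(shsum_map f (tens (f v)) s (w :: t)).
Qed.

Lemma zin_map_iter (V W : lmodType F) (f : {linear V -> W}) x s :
  zin_map f (zinb_iter x s) = zinb_iter (zin_map f x) (map (zin_map f) s).
Proof. by elim: s x => [|y s IH] x //=; rewrite zin_map_zinb IH. Qed.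

Lemma zinb_iter_eta (V : lmodType F) (v : V) s :
  zinb_iter (zin_eta V v) (map (zin_eta V) s) = tens v s.
Proof.
elim: s v => [|w s IH] v //=; rewrite IH zinb_tens.
by rewrite /= big_seq1.
Qed.

Lemma shsum_iter_cons (V : lmodType F) (z x y : Zin V) s t :
  shsum (zinb_iter z) (x :: s) (y :: t)
  = zinb z (shsum (zinb_iter x) s (y :: t) + shsum (zinb_iter y) (x :: s) t).
Proof. by rewrite shsum_cons zinbDr /shsum !zinb_sumr. Qed.

Lemma shsum_iter (V : lmodType F) (x y : Zin V) s t :
  shsum (zinb_iter x) s (y :: t) = zinb (zinb_iter x s) (zinb_iter y t).
Proof.
move: {2}(size s + size t).+1 (leqnn (size s + size t).+1) => n.
elim: n x y s t => [//|n IH] x y [|z s] t ltn; first by rewrite shsum0s.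
rewrite shsum_iter_cons IH; last by move: ltn; rewrite /= addSn.
rewrite shsumC IH; last by move: ltn; rewrite /= addSn addnC.
by rewrite /= zinb_zinbiel zinbDr.
Qed.

Lemma zin_mu_zinb (V : lmodType F) (x y : Zin (Zin V)) :
  zin_mu V (zinb x y) = zinb (zin_mu V x) (zin_mu V y).
Proof.
elim/zin_ind: x => [|a v s x IH]; first by rewrite !(zinb0l, linear0).
rewrite !(zinbDl, zinbZl, linearP) IH /=; congr (_ *: _ + _) => {x IH}.
elim/zin_ind: y => [|b w t y IH]; first by rewrite !(zinb0r, linear0).
rewrite !(zinbDr, zinbZr, linearP) IH /=; congr (_ *: _ + _) => {y IH}.
rewrite zinb_tens !zin_mu_tens linear_sum.
under eq_bigr do rewrite zin_mu_tens.
exact: shsum_iter.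
Qed.

Lemma zin_mu_iter (V : lmodType F) (x : Zin (Zin V)) s :
  zin_mu V (zinb_iter x s) = zinb_iter (zin_mu V x) (map (zin_mu V) s).
Proof. by elim: s x => [|y s IH] x //=; rewrite zin_mu_zinb IH. Qed.

Definition Zin_functor : functor (VEC F) (VEC F).
Proof.
apply: (@Functor (VEC F) (VEC F) (fun V : lmodType F => Zin V : lmodType F)
  (fun (V W : lmodType F) f => zin_map f)).
- move=> V; apply: zin_ext => v s.
  by rewrite zin_map_tens /= map_id.
- move=> U V W g f; apply: zin_ext => v s.
  by rewrite /= !zin_map_tens map_comp.
Defined.

Definition Zin_monad : monad (VEC F).
Proof.
apply: (@Monad (VEC F) Zin_functor zin_eta zin_mu).
- by move=> V W f; apply: linear_ext => v /=; rewrite zin_map_tens.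
- move=> V W f; apply: zin_ext => v s /=.
  by rewrite zin_map_tens !zin_mu_tens zin_map_iter.
- by move=> V; apply: linear_ext => x /=; rewrite zin_mu_tens.
- move=> V; apply: zin_ext => v s /=.
  by rewrite zin_map_tens zin_mu_tens (zinb_iter_eta v s).
- move=> V; apply: zin_ext => v s /=.
  by rewrite zin_map_tens !zin_mu_tens zin_mu_iter.
Defined.
End ZinMonad.

Lemma zin_partial_multi (V : lmodType F) :
  multilinear (fun v s =>
    tens (0 : V, v) [seq (w, 0 : V) | w <- s] : Zin (V * V)%type).
Proof.
have m := tens_multilinear (V * V)%type.
split=> [a u v s|a u v x s t]; first by rewrite inr_linear (mlin_head m).
by rewrite !map_cat /= inl_linear (mlin_tail m).
Qed.

Definition Zin_partial (V : lmodType F) : {linear Zin V -> Zin (V * V)%type} :=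
  zin_lift (zin_partial_multi V).

Lemma zin_eps_multi (V : lmodType F) :
  multilinear (fun (v : V) (s : seq V) => if s is [::] then v else 0).
Proof.
split=> [a u v [|w s]|a u v x [|w s] t] //=; rewrite ?scaler0 ?addr0 //.
Qed.

Definition Zin_eps (V : lmodType F) : {linear Zin V -> V} :=
  zin_lift (zin_eps_multi V).
End Tensor.

(* Main.v *)
Require Import Defs.
From mathcomp Require Import all_boot all_order all_algebra.
From mathcomp Require Import boolp.

(** The statement splits into a general fact about monads on a category with
    biproducts and a computation in the free Zinbiel algebra.

    In general, call a Kleisli map linear when it is [meta S A \oc h] for a map
    [h] of the base category.  Every structural map of the opposite Kleisli
    category (projections, identities, and the maps built from them by sums and
    pairings that occur in the axioms of a differential category) is linear.
    Precomposing [g] with a linear map is postcomposing [g] with [fmap S h] in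
    the base category ([comp_kl_lift]), so the axioms of the differential
    combinator [D f = d \oc f] become those of [d] one by one: additivity in the
    second argument is [dc2] and [dc1], the derivative of identities and
    projections is [dc3], the symmetry axioms [CD6] and [CD7] are [dc5] and
    [dc6], and the chain rule [CD5] is [dc4] together with the naturality of [d]
    ([kleisli_op_is_cdc]).  Moreover [f] is D-linear when
    [d \oc f = fmap S biota1 \oc f]; applying [fmap S bpi1], the axiom [du2] turns
    this into [f = meta S A \oc (e \oc f)] ([D_linearE]), so D-linear maps are the
    linear ones, and [f |-> e \oc f] and [h |-> meta S A \oc h] are inverse
    isomorphisms ([Dlin_kleisli_op]).

    For Zin, every axiom is an equality of linear maps, hence is checked on pure
    tensors, where both sides are computed letter by letter.  The only axiom with
    content is the chain rule [dc4].  It holds because the first letter of a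
    half-shuffle x < y is the first letter of x, so that marking the first letter
    commutes with the product: d(x < y) = d(x) < Zin(iota0)(y)
    ([zinb_first_letter]). *)

Set Implicit Arguments.
Unset Strict Implicit.
Unset Printing Implicit Defensive.

Import Defs GRing.Theory.
Local Open Scope cat_scope.

(** * Copairings in a category with biproducts *)

Section Biproducts.
Variable X : biprod_category.

Lemma haddr0 (A B : X) (f : hom A B) : hadd f (hzero A B) = f.
Proof. by rewrite haddC hadd0. Qed.

Lemma bcopair_iota0 (A B C : X) (f : hom A C) (g : hom B C) :
  bcopair f g \oc biota0 = f.
Proof.
by rewrite comp_haddl -!compA bpi0_iota0 bpi1_iota0 compm1 comp_hzeror haddr0.
Qed.

Lemma bcopair_iota1 (A B C : X) (f : hom A C) (g : hom B C) :
  bcopair f g \oc biota1 = g.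
Proof.
by rewrite comp_haddl -!compA bpi0_iota1 bpi1_iota1 compm1 comp_hzeror hadd0.
Qed.

Lemma bcopair_eta (A B C : X) (h : hom (bprod A B) C) :
  h = bcopair (h \oc biota0) (h \oc biota1).
Proof. by rewrite /bcopair -!compA -comp_haddr biotaK compm1. Qed.

Lemma comp_bcopair (A B C E : X) (h : hom C E) (f : hom A C) (g : hom B C) :
  h \oc bcopair f g = bcopair (h \oc f) (h \oc g).
Proof. by rewrite /bcopair comp_haddr !compA. Qed.

Lemma bprodmE (A B C E : X) (f : hom A C) (g : hom B E) :
  bprodm f g = bcopair (biota0 \oc f) (biota1 \oc g).
Proof. by rewrite /bprodm /bpair /bcopair !compA. Qed.

Lemma bcopair_prodm (A B C E H : X) (f : hom C H) (g : hom E H)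
    (h : hom A C) (k : hom B E) :
  bcopair f g \oc bprodm h k = bcopair (f \oc h) (g \oc k).
Proof.
by rewrite bprodmE comp_bcopair !compA bcopair_iota0 bcopair_iota1.
Qed.

Lemma bdiagE (A : X) : bdiag A = hadd biota0 biota1.
Proof. by rewrite /bdiag /bpair !compm1. Qed.

(** The swap permutes the two middle summands; it is defined as a pairing, and
    this gives it as a copairing, which is what the opposite category calls a
    pairing. *)
Lemma bswapE (A : X) :
  bswap A = bcopair (bprodm biota0 biota0) (bprodm biota1 biota1).
Proof.
rewrite [LHS]bcopair_eta /bswap /bpair !comp_haddl -!compA !bprodmE.
by rewrite !bcopair_iota0 !bcopair_iota1 /bcopair !compA.
Qed.

End Biproducts.

(** * The opposite Kleisli category is a differential category *)

Section KleisliDifferential.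
Variables (X : biprod_category) (S : monad X).
Variable d : forall V : X, hom (S V) (S (bprod V V)).
Hypothesis dS : cartesian_differential_comonad_op d.

Local Notation Y := (kleisli_op S).
Local Notation o := (kleisli_op_clac S).
Local Notation D := (@kleisli_op_D X S d).

Definition kl_lift (A B : X) (h : hom B A) : @hom Y A B := meta S A \oc h.

Lemma kl_compE (A B C : X) (g : @hom Y B C) (f : @hom Y A B) :
  g \oc f = @comp X _ _ _ (mmu S A \oc fmap S f) g.
Proof. by []. Qed.

Lemma kl_DE (A B : X) (f : @hom Y A B) : D f = @comp X _ _ _ (d A) f.
Proof. by []. Qed.

Lemma kl_lpairE (A B C : X) (f : @hom Y C A) (g : @hom Y C B) :
  lpair o f g = @bcopair X _ _ _ f g.
Proof. by []. Qed.

(** The reduction principle of the whole section: a structural map acts in the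
    opposite Kleisli category through the functor alone, without the monad
    multiplication. *)
Lemma comp_kl_lift (A B C : X) (h : hom B A) (g : @hom Y B C) :
  g \oc kl_lift h = @comp X _ _ _ (fmap S h) g.
Proof.
by rewrite kl_compE /kl_lift fmap_comp compA mmu_fmap_meta comp1m.
Qed.

Lemma kl_lift_comp (A B C : X) (h : hom C B) (f : @hom Y A B) :
  kl_lift h \oc f = @comp X _ _ _ f h.
Proof.
rewrite kl_compE /kl_lift -compA.
by rewrite (compA (fmap S f)) meta_nat !compA mmu_meta comp1m.
Qed.

Lemma kl_lpi0 (A B : X) : @lpi0 Y o A B = kl_lift biota0.
Proof. by []. Qed.

Lemma kl_lpi1 (A B : X) : @lpi1 Y o A B = kl_lift biota1.
Proof. by []. Qed.

Lemma kl_lpair (A B C : X) (h : hom A C) (k : hom B C) :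
  lpair o (kl_lift h) (kl_lift k) = kl_lift (bcopair h k).
Proof. by rewrite kl_lpairE /kl_lift -comp_bcopair. Qed.

Lemma kl_id (A : X) : @idm Y A = kl_lift (idm A).
Proof. by rewrite /kl_lift compm1. Qed.

Lemma kl_add (A B : X) (h k : hom B A) :
  ladd o (kl_lift h) (kl_lift k) = kl_lift (hadd h k).
Proof. by rewrite /kl_lift comp_haddr. Qed.

Lemma kl_zero (A B : X) : lzero o A B = kl_lift (hzero B A).
Proof. by rewrite /kl_lift comp_hzeror. Qed.

Lemma kl_comp (A B C : X) (h : hom C B) (k : hom B A) :
  kl_lift h \oc kl_lift k = kl_lift (k \oc h).
Proof. by rewrite kl_lift_comp /kl_lift compA. Qed.

Lemma kl_lprodm (A B C E : X) (h : hom C A) (k : hom E B) :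
  lprodm o (kl_lift h) (kl_lift k) = kl_lift (bprodm h k).
Proof. by rewrite /lprodm !kl_lpi0 kl_lpi1 !kl_comp kl_lpair -bprodmE. Qed.

Lemma kleisli_op_is_clac : is_clac o.
Proof.
split.
- by move=> A B f g h; exact: haddA.
- by move=> A B f g; exact: haddC.
- by move=> A B f; exact: hadd0.
- by move=> A B C f g x; exact: comp_haddr.
- by move=> A B C x; exact: comp_hzeror.
- move=> A; exists (hzero _ _) => t'.
  (* A map out of the zero object factors through its identity, which is 0. *)
  rewrite -[LHS](@compm1 X (zero_obj) (S A) t') (zero_objP X).
  exact: comp_hzeror.
- by move=> A B C f g; rewrite kl_lpi0 kl_lift_comp; exact: bcopair_iota0.
- by move=> A B C f g; rewrite kl_lpi1 kl_lift_comp; exact: bcopair_iota1.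
- move=> A B C f g h <- <-; rewrite kl_lpi0 kl_lpi1 !kl_lift_comp.
  exact: bcopair_eta.
- split=> [C x y|C]; rewrite kl_lpi0 !kl_lift_comp; first exact: comp_haddl.
  exact: comp_hzerol.
- split=> [C x y|C]; rewrite kl_lpi1 !kl_lift_comp; first exact: comp_haddl.
  exact: comp_hzerol.
Qed.

Lemma kl_D_lift (A B : X) (h : hom B A) :
  D (kl_lift h) = kl_lift (biota1 \oc h).
Proof. by rewrite /kleisli_op_D /kl_lift !compA (dc3 dS). Qed.

(** Each axiom is proved by writing the structural maps as lifts of maps of the
    base category and then quoting the axiom of [d] that the lift uncovers. *)
Theorem kleisli_op_is_cdc : is_cdc D.
Proof.
split.
- exact: kleisli_op_is_clac.
- by move=> A B f g; exact: comp_haddr.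
- by move=> A B; exact: comp_hzeror.
- move=> A B f; rewrite /lnabla kl_lpi0 kl_lpi1 kl_add kl_id !kl_lprodm.
  rewrite !comp_kl_lift -bdiagE !kl_DE compA (dc2 dS).
  by rewrite !comp_haddl -!compA.
- move=> A B f; rewrite /liota0 kl_id kl_zero kl_lpair comp_kl_lift.
  rewrite /bcopair comp1m comp_hzerol haddr0 kl_DE compA (dc1 dS).
  exact: comp_hzerol.
- by move=> A; rewrite kl_id kl_D_lift compm1.
- by move=> A B; rewrite !kl_lpi0 !kl_lpi1 kl_D_lift kl_comp.
- by move=> A B; rewrite !kl_lpi1 kl_D_lift kl_comp.
- by move=> A B C f g; exact: comp_bcopair.
- move=> A B C g f; rewrite kl_lpi0 comp_kl_lift.
  rewrite kl_lpairE !kl_DE !kl_compE.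
  rewrite -bcopair_prodm fmap_comp !compA (dc4 dS).
  by rewrite -(compA _ _ (d B)) (dc_nat dS) compA.
- move=> A B f; rewrite /lell /liota0 /liota1 kl_id kl_zero !kl_lpair.
  rewrite kl_lprodm comp_kl_lift /bcopair !comp1m !comp_hzerol haddr0 hadd0.
  by rewrite !kl_DE !compA (dc5 dS).
- move=> A B f; rewrite /lswap !kl_lpi0 !kl_lpi1 !kl_lprodm kl_lpair.
  rewrite comp_kl_lift -bswapE.
  by rewrite !kl_DE !compA (dc6 dS).
Qed.

(** * D-linear maps are the maps of the base category *)

Variable e : forall V : X, hom (S V) V.
Hypothesis eS : D_linear_unit_op d e.

Lemma D_linear_kl_lift (A B : X) (h : hom B A) : D_linear D (kl_lift h).
Proof. by rewrite /D_linear kl_D_lift kl_lpi1 kl_comp. Qed.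

(** D-linearity says [d \oc f = fmap S biota1 \oc f]; composing with [fmap S bpi1]
    gives [fmap S bpi1 \oc d \oc f = f], whose left-hand side is
    [meta S A \oc e A \oc f] by [du2]. *)
Lemma D_linearE (A B : X) (f : @hom Y A B) :
  D_linear D f -> f = kl_lift (@comp X _ _ _ (e A) f).
Proof.
rewrite /D_linear kl_lpi1 comp_kl_lift /kl_lift => Df.
rewrite compA (du2 eS) -[RHS]compA [X in _ \oc X]Df compA -fmap_comp.
by rewrite bpi1_iota1 fmap_id comp1m.
Qed.

Lemma e_kl_lift (A B : X) (h : hom B A) : @comp X _ _ _ (e A) (kl_lift h) = h.
Proof. by rewrite /kl_lift compA (du1 eS) comp1m. Qed.

Lemma e_comp (A B C : X) (g : @hom Y B C) (f : @hom Y A B) :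
  D_linear D g -> D_linear D f ->
  @comp X _ _ _ (e A) (g \oc f)
  = @comp X _ _ _ (@comp X _ _ _ (e A) f) (@comp X _ _ _ (e B) g).
Proof.
by move=> /D_linearE-> /D_linearE->; rewrite kl_comp !e_kl_lift.
Qed.

(** Stated for functors with one object map, so that comparing their actions on
    maps needs no transport along an equality of objects. *)
Lemma functor_ext (X1 X2 : category) (o1 : X1 -> X2)
    (m m' : forall A B, hom A B -> hom (o1 A) (o1 B)) i i' c c' :
  (forall A B f, m A B f = m' A B f) ->
  @Functor X1 X2 o1 m i c = @Functor X1 X2 o1 m' i' c'.
Proof.
move=> mm'; have E : m = m'.
  by do 3 apply: functional_extensionality_dep => ?.
by case: _ / E i' c' {mm'} => i' c'; congr Functor; apply: Prop_irrelevance.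
Qed.

Theorem Dlin_kleisli_op (cdc : is_cdc D) :
  isomorphic_categories (Dlin cdc) (op_category X).
Proof.
have Gid (A : Dlin cdc) : @comp X _ _ _ (e A) (sval (idm A)) = @idm X A.
  exact: (du1 eS).
have Gcomp (A B C : Dlin cdc) (g : hom B C) (f : hom A B) :
    @comp X _ _ _ (e A) (sval (g \oc f))
    = @comp X _ _ _ (@comp X _ _ _ (e A) (sval f))
        (@comp X _ _ _ (e B) (sval g)).
  exact: e_comp (svalP g) (svalP f).
pose G := @Functor (Dlin cdc) (op_category X) (fun A => A)
  (fun A B f => @comp X _ _ _ (e A) (sval f)) Gid Gcomp.
pose h (A B : op_category X) (f : hom A B) : @hom (Dlin cdc) A B :=
  exist _ (@kl_lift A B f) (D_linear_kl_lift f).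
have Hid (A : op_category X) : h A A (idm A) = @idm (Dlin cdc) A.
  by apply: Dlin_hom_eq; exact/esym/kl_id.
have Hcomp (A B C : op_category X) (g : hom B C) (f : hom A B) :
    h A C (g \oc f) = h B C g \oc h A B f.
  by apply: Dlin_hom_eq; exact/esym/kl_comp.
pose H := @Functor (op_category X) (Dlin cdc) (fun A => A) h Hid Hcomp.
exists G, H; split; apply: functor_ext => A B f /=.
- by apply: Dlin_hom_eq; exact/esym/D_linearE/svalP.
- exact: e_kl_lift.
Qed.

End KleisliDifferential.

(** * The free Zinbiel algebra *)

Local Open Scope ring_scope.

Section ZinDifferential.
Variable F : fieldType.

Lemma Zin_partial_tens (V : lmodType F) (v : V) s :
  Zin_partial V (tens v s) = tens (0 : V, v) [seq (w, 0 : V) | w <- s].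
Proof. exact: zin_lift_tens. Qed.

Lemma Zin_eps_tens (V : lmodType F) (v : V) s :
  Zin_eps V (tens v s) = if s is [::] then v else 0.
Proof. exact: zin_lift_tens. Qed.

Lemma tens0 (V : lmodType F) (s : seq V) : tens 0 s = 0.
Proof.
have := mlin_head (tens_multilinear V) 1 0 0 s.
by rewrite !scale1r addr0 => /eqP; rewrite -subr_eq subrr => /eqP/esym.
Qed.

Lemma tens0_tail (V : lmodType F) (v : V) s t : tens v (s ++ 0 :: t) = 0.
Proof.
have := mlin_tail (tens_multilinear V) 1 0 0 v s t.
by rewrite !scale1r addr0 => /eqP; rewrite -subr_eq subrr => /eqP/esym.
Qed.

Lemma tensDl (V : lmodType F) (u v : V) s : tens (u + v) s = tens u s + tens v s.
Proof. by rewrite -[u]scale1r (mlin_head (tens_multilinear V)) !scale1r. Qed.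

(** [g] stands for the map [bprodm f f], which is a sum of two injections and is
    equal to [(u, v) |-> (f u, f v)] only after computing that sum. *)
Lemma Zin_partial_map (V W : lmodType F) (f : {linear V -> W})
    (g : {linear (V * V)%type -> (W * W)%type}) x :
  (forall u v, g (u, v) = (f u, f v)) ->
  zin_map g (Zin_partial V x) = Zin_partial W (zin_map f x).
Proof.
move=> gE; pose l : {linear Zin V -> Zin (W * W)%type} :=
  zin_map g \o Zin_partial V.
pose l' : {linear Zin V -> Zin (W * W)%type} := Zin_partial W \o zin_map f.
suff E : l = l'.
  exact: (congr1 (fun h : {linear Zin V -> Zin (W * W)%type} => h x) E).
apply: zin_ext => v s; rewrite /l /l' /=.
rewrite Zin_partial_tens !zin_map_tens Zin_partial_tens gE linear0 -!map_comp.
by congr tens; apply: eq_map => w /=; rewrite gE linear0.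
Qed.

(** A half-shuffle keeps the first letter of its left factor in front, and all
    the other letters of both factors are only interleaved.  So a map that acts
    by [k] on the first letter and by [i] on the others sees [k] once, at the
    head of [x], and treats [y] as [zin_map i] does. *)
Lemma zinb_first_letter (V W : lmodType F) (k : V -> W) (i : {linear V -> W})
    (d : {linear Zin V -> Zin W}) (x y : Zin V) :
  (forall v s, d (tens v s) = tens (k v) (map i s)) ->
  d (zinb x y) = zinb (d x) (zin_map i y).
Proof.
move=> dE; elim/zin_ind: x => [|a v s x IH]; first by rewrite !(zinb0l, linear0).
rewrite !(zinbDl, zinbZl, linearP) IH /=; congr (_ *: _ + _) => {x IH}.
elim/zin_ind: y => [|b w t y IH]; first by rewrite !(zinb0r, linear0).
rewrite !(zinbDr, zinbZr, linearP) IH /=; congr (_ *: _ + _) => {y IH}.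
rewrite dE zin_map_tens !zinb_tens linear_sum.
under eq_bigr do rewrite dE.
exact/esym/(shsum_map i (tens (k v)) s (w :: t)).
Qed.

(** The chain rule: in an iterated product only the leftmost factor contributes
    the first letter. *)
Lemma Zin_partial_iter (V : lmodType F) (x : Zin V) s :
  Zin_partial V (zinb_iter x s)
  = zinb_iter (Zin_partial V x) (map (zin_map (mk_linear (@inl_linear F V V))) s).
Proof.
case: s => [|y s] //=; rewrite -zin_map_iter.
by apply: (zinb_first_letter (k := fun v => (0, v))) => v t; exact: Zin_partial_tens.
Qed.

Lemma pairD (U V : lmodType F) (a c : U) (b e : V) :
  (a, b) + (c, e) = (a + c, b + e).
Proof. by []. Qed.

Lemma zin_map_partial (V W : lmodType F) (g : {linear (V * V)%type -> W}) v s :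
  zin_map g (Zin_partial V (tens v s)) = tens (g (0, v)) [seq g (w, 0) | w <- s].
Proof. by rewrite Zin_partial_tens zin_map_tens -map_comp. Qed.

Lemma zin_map_partial2 (V W : lmodType F)
    (g : {linear ((V * V) * (V * V))%type -> W}) v s :
  zin_map g (Zin_partial (V * V)%type (Zin_partial V (tens v s)))
  = tens (g (0, (0, v))) [seq g ((w, 0), 0) | w <- s].
Proof. by rewrite Zin_partial_tens zin_map_partial -map_comp. Qed.

Theorem Zin_comonad :
  cartesian_differential_comonad_op (X := VEC F) (S := Zin_monad F)
    (fun V => Zin_partial V).
Proof.
split.
- move=> V W f; apply: linear_ext => x /=; apply: Zin_partial_map => u v /=.
  by rewrite pairD addr0 add0r.
- move=> V; apply: zin_ext => v s /=.
  by rewrite zin_map_partial tens0.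
- move=> V; apply: zin_ext => v s /=; rewrite !zin_map_partial /=.
  rewrite !pairD !(add0r, addr0).
  by rewrite /= -tensDl !pairD !(add0r, addr0).
- by move=> V; apply: linear_ext => v /=; rewrite Zin_partial_tens.
- move=> V; apply: zin_ext => x s /=.
  rewrite zin_mu_tens zin_map_partial zin_mu_tens /=.
  (* The copairing is evaluated at (0, x) and at the letters (y, 0), where one
     of its two summands vanishes. *)
  rewrite linear0 add0r.
  rewrite Zin_partial_iter; congr zinb_iter.
  by apply: eq_map => y /=; rewrite linear0 addr0.
- move=> V; apply: zin_ext => v s /=.
  rewrite zin_map_partial2 Zin_partial_tens /= !pairD !(addr0, add0r).
  by congr tens; apply: eq_map => w /=; rewrite !pairD !(addr0, add0r).
- move=> V; apply: zin_ext => v s /=.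
  rewrite zin_map_partial2 !Zin_partial_tens -map_comp /= !pairD !(addr0, add0r).
  by congr tens; apply: eq_map => w /=; rewrite !pairD !(addr0, add0r).
Qed.

Theorem Zin_unit :
  D_linear_unit_op (X := VEC F) (S := Zin_monad F)
       (fun V => Zin_partial V) (fun V => Zin_eps V).
Proof.
split.
- move=> V W f; apply: zin_ext => v s /=.
  by rewrite zin_map_tens !Zin_eps_tens; case: s => //=; rewrite linear0.
- by move=> V; apply: linear_ext => v /=; rewrite Zin_eps_tens.
- move=> V; apply: zin_ext => v s /=.
  rewrite Zin_eps_tens Zin_partial_tens zin_map_tens /=.
  case: s => [|w s] //=.
  by rewrite tens0 (tens0_tail v [::]).
Qed.
End ZinDifferential.

Theorem corollary7p6 (F : fieldType) :
  cartesian_differential_comonad_op (X := VEC F) (S := Zin_monad F)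
    (fun V => Zin_partial V)
  /\ D_linear_unit_op (X := VEC F) (S := Zin_monad F)
       (fun V => Zin_partial V) (fun V => Zin_eps V)
  /\ exists cdc : is_cdc (o := kleisli_op_clac (Zin_monad F))
                    (@kleisli_op_D (VEC F) (Zin_monad F)
                       (fun V => Zin_partial V)),
       isomorphic_categories (Dlin cdc) (op_category (VEC F)).
Proof.
have dS := Zin_comonad F; have eS := Zin_unit F.
split=> //; split=> //; exists (kleisli_op_is_cdc dS).
exact: (Dlin_kleisli_op dS eS).
Qed.
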